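(* Let $M \subset \mathbb{R}^q$ be compact and let $f_\mu : \mathbb{R}^p \to \mathbb{R}^p$, $\mu \in M$, be a family of maps that varies continuously in phase space and in $\mu$. Suppose that for each $\mu \in M$ the map $f_\mu$ has an attractor $\mathcal{A}_\mu$, and let $r_\mu > 0$ be such that $d_a(f_\mu^n(x), \mathcal{A}_\mu) \to 0$ as $n \to \infty$ for all $x \in B_{r_\mu}(\mathcal{A}_\mu)$. Suppose that: (A1) there exists a compact set $\Omega \subset \mathbb{R}^p$ such that $B_{r_\mu}(\mathcal{A}_\mu) \subseteq \Omega$ for all $\mu \in M$; (A2) for all $\mu \in M$ there exists a compact set $N_\mu \subseteq \Omega$, continuous with respect to $\mu$ in the Hausdorff metric, such that $f_\mu(N_\mu) \subseteq N_\mu$ and $\mathcal{A}_\mu = \mathrm{cl}\left( \bigcap_{n=0}^\infty f_\mu^n(N_\mu) \right)$. Then $\mathcal{A}_\mu$ is continuous in the Hausdorff metric on a residual subset of $M$.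
   Context: Let $d$ be a metric on $\mathbb{R}^p$ (inducing the usual topology). For $X, Y \subseteq \mathbb{R}^p$ put $d_a(X,Y) = \sup_{x \in X} \inf_{y \in Y} d(x,y)$, $d_H(X,Y) = \max[d_a(X,Y), d_a(Y,X)]$, and $B_r(X) = \{ y \in \mathbb{R}^p : d_a(y,X) \le r \}$, where $d_a(y,X)$ means $d_a(\{y\},X)$. Attractor: for a continuous map $f$ on $\mathbb{R}^p$, a (nonempty) compact set $\mathcal{A} \subset \mathbb{R}^p$ is an attractor of $f$ if (i) $f(\mathcal{A}) = \mathcal{A}$; (ii) $\mathcal{A}$ contains a dense orbit; (iii) there exists $r>0$ such that $d_a(f^n(x), \mathcal{A}) \to 0$ as $n \to \infty$ for all $x \in B_r(\mathcal{A})$. ''The family $f_\mu$ varies continuously in phase space and in $\mu$'' means that $(\mu,x) \mapsto f_\mu(x)$ is continuous on $M \times \mathbb{R}^p$. A family of compact sets $S_\mu$, $\mu \in M$, is continuous in the Hausdorff metric at $\mu \in M$ if for all $\varepsilon>0$ there is $\delta>0$ such that $d_H(S_\mu,S_\nu)<\varepsilon$ whenever $\nu \in M$ and $|\mu-\nu|<\delta$. In the conclusion, ''continuous on a residual subset'' means that the set of points $\mu\in M$ at which $\mu \mapsto \mathcal{A}_\mu$ (as a map on $M$) is continuous contains a residual subset of $M$. A residual subset of $M$ is the complement in $M$ of a countable union of nowhere dense subsets of $M$. *)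

(* Defs.v *)
From HB Require Import structures.
From mathcomp Require Import all_boot all_order all_algebra.
From mathcomp Require Import all_classical all_reals all_analysis.
Import Order.TTheory GRing.Theory Num.Theory.
Import numFieldNormedType.Exports.

Set Implicit Arguments.
Unset Strict Implicit.
Unset Printing Implicit Defensive.

Local Open Scope classical_set_scope.
Local Open Scope ring_scope.

(* [d] is an arbitrary metric, unrelated to the norm of the library; it is only
   required to induce the given topology of [T] (last field). *)
Record compatible_metric (R : realType) (T : topologicalType)
    (d : T -> T -> R) : Prop := CompatibleMetric {
  cmetric_ge0 : forall x y, 0 <= d x y;
  cmetric_eq0 : forall x y, d x y = 0 <-> x = y;
  cmetric_sym : forall x y, d x y = d y x;
  cmetric_triangle : forall x y z, d x z <= d x y + d y z;
  cmetric_open : forall U : set T, open U <->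
    forall x, U x -> exists2 e : R, 0 < e & [set y | d x y < e] `<=` U
}.

(* Distances between sets take values in [\bar R], because the supremum may be
   infinite; the supremum over the empty set is -oo and the infimum over the
   empty set is +oo. *)
Definition dist_a (R : realType) (T : Type) (d : T -> T -> R)
    (X Y : set T) : \bar R :=
  ereal_sup [set ereal_inf [set (d x y)%:E | y in Y] | x in X].

Definition dist_H (R : realType) (T : Type) (d : T -> T -> R)
    (X Y : set T) : \bar R :=
  Order.max (dist_a d X Y) (dist_a d Y X).

Definition nbhd_ball (R : realType) (T : Type) (d : T -> T -> R)
    (r : R) (X : set T) : set T :=
  [set y | (dist_a d [set y] X <= r%:E)%E].

Definition attracts (R : realType) (T : Type) (d : T -> T -> R)
    (f : T -> T) (A : set T) (r : R) : Prop :=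
  forall x, nbhd_ball d r A x ->
    dist_a d [set iter n f x] A @[n --> \oo] --> 0%E.

Definition orbit_set (T : Type) (f : T -> T) (x : T) : set T :=
  [set iter n f x | n in [set: nat]].

Record is_attractor (R : realType) (T : topologicalType) (d : T -> T -> R)
    (f : T -> T) (A : set T) : Prop := IsAttractor {
  attractor_nonempty : A !=set0;
  attractor_compact : compact A;
  attractor_invariant : f @` A = A;
  attractor_dense_orbit :
    exists x, orbit_set f x `<=` A /\ A `<=` closure (orbit_set f x);
  attractor_attracts : exists2 r : R, 0 < r & attracts d f A r
}.

Definition hausdorff_continuous_at (R : realType) (V : normedModType R)
    (T : Type) (d : T -> T -> R) (M : set V) (S : V -> set T) (mu : V) : Prop :=
  forall eps : R, 0 < eps -> exists2 delta : R, 0 < delta &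
    forall nu, M nu -> `|mu - nu| < delta ->
      (dist_H d (S mu) (S nu) < eps%:E)%E.

Definition nowhere_dense (T : topologicalType) (S : set T) : Prop :=
  interior (closure S) = set0.

(* Closure and interior are taken in [subspace M], whose carrier is all of [T]
   but in which the points outside [M] are isolated and [M] is clopen with its
   relative topology; for [F n `<=` M] this is nowhere density in [M]. *)
Definition residual_in (T : topologicalType) (M S : set T) : Prop :=
  exists F : nat -> set T,
    (forall n, F n `<=` M /\ @nowhere_dense (subspace M) (F n)) /\
    S = M `\` \bigcup_n F n.

(* Main.v *)
Require Import Defs.
From HB Require Import structures.
From mathcomp Require Import all_boot all_order all_algebra.
From mathcomp Require Import all_classical all_reals all_analysis.
Import Order.TTheory GRing.Theory Num.Theory.
Import numFieldNormedType.Exports.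
Set Implicit Arguments.
Unset Strict Implicit.
Unset Printing Implicit Defensive.

Local Open Scope classical_set_scope.
Local Open Scope ring_scope.

(** The sets [iter n (f mu) @` N mu] are compact, so [A mu] is exactly their
    intersection, and the attractors are the fibres of one compact subset [G]
    of the product of the parameter space and the phase space. Indeed,
    Hausdorff continuity gives [N] a closed, hence compact, graph; the skew
    product (mu, x) |-> (mu, f mu x) is continuous, so its iterates carry this
    graph to compact sets, whose fibres are the [iter n (f mu) @` N mu]; and [G]
    is the intersection of these images ([compact_graph_bigcap_iter]).

    Compactness of [G] makes mu |-> A mu upper semicontinuous: for closed [C],
    the parameters whose attractor meets [C] are the projection of a compact
    set, hence form a closed set ([closed_hitting_set]).

    Lower semicontinuity can fail, but only on a meagre set. If it fails at
    [mu], then some point of [A mu] has a neighbourhood missed by [A nu] for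
    [nu] arbitrarily close to [mu]. This neighbourhood may be taken to be the
    closure [C] of a member of a fixed countable basis, and then [mu] belongs to
    the closed set of parameters whose attractor meets [C], but not to its
    interior. A closed set minus its interior is nowhere dense, and there are
    countably many choices of [C] ([lower_semicontinuous_residual]).

    Off this meagre set both semicontinuities hold, and for a compact value
    [A mu] they amount to continuity in the Hausdorff metric
    ([hausdorff_continuous_semicontinuous]). *)

(** * Metrics compatible with a topology *)

Lemma compatible_metric_nbhs (R : realType) (T : topologicalType)
    (d : T -> T -> R) (hd : compatible_metric d) (x : T) (U : set T) :
  nbhs x U <-> exists2 e : R, 0 < e & [set y | d x y < e] `<=` U.
Proof.
split=> [|[e e0 eU]].
  rewrite nbhsE => -[V [oV Vx] VU].
  have [e e0 eV] := (cmetric_open hd V).1 oV x Vx.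
  by exists e => //; exact: subset_trans eV VU.
rewrite nbhsE; exists [set y | d x y < e] => //; split.
  apply/(cmetric_open hd) => y /= xy; exists (e - d x y).
    by rewrite subr_gt0.
  move=> z /=; rewrite ltrBrDl; apply: le_lt_trans.
  exact: cmetric_triangle hd _ _ _.
by rewrite /= (cmetric_eq0 hd x x).2.
Qed.

Lemma dist_a_lt (R : realType) (T : Type) (d : T -> T -> R) (X Y : set T)
    (e : R) (x : T) :
  (dist_a d X Y < e%:E)%E -> X x -> exists2 y, Y y & d x y < e.
Proof.
move=> XYe Xx.
have /ereal_inf_lt[_ [y Yy <-]] :
    (ereal_inf [set (d x y)%:E | y in Y] < e%:E)%E.
  by apply: le_lt_trans XYe; apply: ereal_sup_ubound; exists x.
by rewrite lte_fin => xye; exists y.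
Qed.

Lemma dist_a_le (R : realType) (T : Type) (d : T -> T -> R) (X Y : set T)
    (e : R) :
  (forall x, X x -> exists2 y, Y y & d x y < e) -> (dist_a d X Y <= e%:E)%E.
Proof.
move=> XY; apply: ge_ereal_sup => _ [x /XY[y Yy xye] <-].
apply: (@le_trans _ _ (d x y)%:E); last by rewrite lee_fin ltW.
by apply: ereal_inf_lbound; exists y.
Qed.

(** Turns the bound [delta] of [hausdorff_continuous_at] into a neighbourhood
    filter, so that finitely many such bounds combine by filter reasoning. *)
Lemma near_within_normP (R : realType) (V : normedModType R) (M : set V)
    (mu : V) (P : V -> Prop) :
  (exists2 e : R, 0 < e & forall nu, M nu -> `|mu - nu| < e -> P nu) <->
  \forall nu \near within M (nbhs mu), P nu.
Proof.
rewrite near_withinE; split=> [[e e0 eP]|].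
  by apply/nbhs_normP; exists e => // nu /= mn Mn; exact: eP.
by move=> /nbhs_normP[e /= e0 eP]; exists e => // nu Mn mn; exact: eP.
Qed.

(** * Closed and compact graphs *)

(** If [x] is at distance at least [e] from the closed set [S mu], then for
    [nu] so close to [mu] that every point of [S nu] is within [e / 2] of
    [S mu], the set [S nu] stays at distance at least [e / 2] from [x]. *)
Lemma hausdorff_continuous_closed_graph (R : realType) (V : normedModType R)
    (T : topologicalType) (d : T -> T -> R) (hd : compatible_metric d)
    (M : set V) (S : V -> set T) :
  closed M -> (forall mu, M mu -> closed (S mu)) ->
  (forall mu, M mu -> hausdorff_continuous_at d M S mu) ->
  closed [set z : V * T | M z.1 /\ S z.1 z.2].
Proof.
move=> cM cS hS [mu x] clx.
have Mmu : M mu.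
  apply: cM => W Wmu.
  have [|[nu y] [[/= Mnu _] [/= Wnu _]]] := clx (W `*` setT).
    by exists (W, setT) => //; split=> //; exact: filterT.
  by exists nu.
split=> //=; apply: contrapT => Sx.
have /(compatible_metric_nbhs hd)[e e0 eS] : nbhs x (~` S mu).
  by apply: open_nbhs_nbhs; split => //; apply: closed_openC; exact: cS.
have e20 : 0 < e / 2 by rewrite divr_gt0.
have /near_within_normP := hS _ Mmu _ e20.
rewrite near_withinE => Whd.
have xb : nbhs x [set y | d x y < e / 2].
  by apply/(compatible_metric_nbhs hd); exists (e / 2).
have [|[nu y] [[/= Mnu Sy] [/= /(_ Mnu) hnu xy]]] := clx (
  [set nu | M nu -> (dist_H d (S mu) (S nu) < (e / 2)%:E)%E] `*`
  [set y | d x y < e / 2]).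
  by eexists (_, _); last exact: subset_refl.
have [|z Sz yz] := dist_a_lt (e := e / 2) (X := S nu) (Y := S mu) (d := d) _ Sy.
  by apply: le_lt_trans hnu; rewrite le_max lexx orbT.
apply: (eS z) => //=; rewrite [e]splitr.
by apply: le_lt_trans (cmetric_triangle hd x y z) _; exact: ltrD.
Qed.

(** The map [phi] below is the skew product over the identity of the parameter
    space: working with it instead of with each [f mu] separately makes
    compactness uniform in the parameter. *)
Lemma compact_graph_bigcap_iter (X T : topologicalType) (M : set X)
    (f : X -> T -> T) (S : X -> set T) :
  hausdorff_space (X * T)%type ->
  {within M `*` [set: T], continuous (fun z : X * T => f z.1 z.2)} ->
  compact [set z : X * T | M z.1 /\ S z.1 z.2] ->
  compact [set z : X * T | M z.1 /\ (\bigcap_n (iter n (f z.1) @` S z.1)) z.2].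
Proof.
move=> hXT cf cG.
pose G n := [set z : X * T | M z.1 /\ (iter n (f z.1) @` S z.1) z.2].
pose phi (z : X * T) := (z.1, f z.1 z.2).
have cphi : {within M `*` [set: T], continuous phi}.
  apply/subspace_continuousP => z Mz.
  apply: (@cvg_pair _ _ _ _ (nbhs z.1) (nbhs (f z.1 z.2))).
    by apply: cvg_within_filter; exact: cvg_fst.
  by move/subspace_continuousP : cf; exact.
have GS n : G n.+1 = phi @` G n.
  apply/seteqP; split=> [[mu x] [/= Mmu [y Sy <-]]|].
    by exists (mu, iter n (f mu) y) => //; split=> //=; exists y.
  move=> _ [[mu _] [/= Mmu [y Sy <-]] <-].
  by split=> //=; exists y.
have cGn n : compact (G n).
  elim: n => [|n IH].
    congr compact : cG; apply/seteqP; split=> [z [Mz Sz]|z [Mz [y Sy yz]]].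
      by split=> //; exists z.2.
    by split=> //; rewrite -yz.
  rewrite GS; apply: continuous_compact => //.
  by apply: continuous_subspaceW cphi => z [].
have -> : [set z : X * T | M z.1 /\ (\bigcap_n (iter n (f z.1) @` S z.1)) z.2] =
    \bigcap_n G n.
  apply/seteqP; split=> [z [Mz Sz] n _|z Gz]; first by split=> //; exact: Sz.
  by split=> [|n _]; [have [] := Gz 0 I | have [] := Gz n I].
apply: (subclosed_compact _ (cGn 0)); last by move=> z; exact.
by apply: closed_bigI => n _; exact: compact_closed.
Qed.

(** The fibres of a compact set form an upper semicontinuous family; the
    statement says so through closed preimages, which is what the category
    argument below takes as input. *)
Lemma closed_hitting_set (X T : topologicalType) (G : set (X * T)) (C : set T) :
  hausdorff_space X -> compact G -> closed C ->
  closed [set mu | [set x | G (mu, x)] `&` C !=set0].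
Proof.
move=> hX cG cC.
have -> : [set mu | [set x | G (mu, x)] `&` C !=set0] =
    fst @` (G `&` (snd @^-1` C)).
  apply/seteqP; split=> [mu [x [Gx Cx]]|_ [[mu x] [Gx Cx] <-]].
    by exists (mu, x).
  by exists x.
apply: (compact_closed hX); apply: continuous_compact.
  by apply: continuous_subspaceT => z; exact: cvg_fst.
apply: compact_closedI => //; apply: preimage_closed => // z _.
exact: cvg_snd.
Qed.

(** * Semicontinuity on a residual set *)

Lemma nowhere_dense_closedD_interior (X : topologicalType) (E : set X) :
  closed E -> nowhere_dense (E `\` E°).
Proof.
move=> cE; rewrite /nowhere_dense.
have /closure_id <- : closed (E `\` E°).
  rewrite setDE; apply: closedI => //.
  by apply: open_closedC; exact: open_interior.
rewrite -subset0 => x xE.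
have [_] := interior_subset xE; apply.
by apply: filterS xE => y [].
Qed.

(** For a basic open set [U] let [E U] be the closed set of parameters whose
    value meets the closure of [U]. Outside all the boundaries of the sets
    [E U], a value that meets the closure of [U] keeps doing so under small
    perturbations of the parameter; regularity provides inside any
    neighbourhood of a point the closure of a basic neighbourhood of it. *)
Lemma lower_semicontinuous_residual (X T : topologicalType) (K : X -> set T) :
  @second_countable T -> regular_space T ->
  (forall C, closed C -> closed [set mu | K mu `&` C !=set0]) ->
  exists F : nat -> set X,
    (forall n, F n `<=` [set mu | K mu !=set0] /\ nowhere_dense (F n)) /\
    forall mu, ~ (\bigcup_n F n) mu -> forall x U, K mu x -> nbhs x U ->
      \forall nu \near mu, K nu `&` U !=set0.
Proof.
move=> [B cB [oB bB]] regT hK.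
pose E U := [set mu | K mu `&` closure U !=set0].
have cE U : closed (E U) by apply: hK; exact: closed_closure.
(* The empty set is a harmless default when the basis is empty. *)
have [b Bb] : exists b : nat -> set T, forall U, B U -> exists n, b n = U.
  have /pfcard_geP[->|[b]] := cB; first by exists (fun=> set0).
  exists b => U BU; have [n _ <-] := @surj _ _ _ _ b U BU.
  by exists n.
exists (fun n => E (b n) `\` (E (b n))°); split=> [n|mu Fmu x U Kx xU].
  split; last exact: nowhere_dense_closedD_interior.
  by move=> mu [[x [Kx _]] _]; exists x.
have [W xW WU] := regT x U xU.
have [Y [/Bb[n <-] bx] bW] := bB x W xW.
have : (E (b n))° mu.
  apply: contrapT => Emu; apply: Fmu; exists n => //; split=> //.
  by exists x; split=> //; exact: subset_closure.
apply: filterS => nu [y [Ky Cy]]; exists y; split=> //.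
by apply: WU; exact: closure_subset Cy.
Qed.

(** * From semicontinuity to the Hausdorff metric *)

(** Upper semicontinuity is applied to a metric neighbourhood of [S mu]. Lower
    semicontinuity is a condition at each point of [S mu] separately, and
    compactness of [S mu] makes it uniform over these points. *)
Lemma hausdorff_continuous_semicontinuous (R : realType) (V : normedModType R)
    (T : topologicalType) (d : T -> T -> R) (hd : compatible_metric d)
    (M : set V) (S : V -> set T) (mu : V) :
  compact (S mu) ->
  (forall U, open U -> S mu `<=` U ->
    \forall nu \near within M (nbhs mu), S nu `<=` U) ->
  (forall x U, S mu x -> nbhs x U ->
    \forall nu \near within M (nbhs mu), S nu `&` U !=set0) ->
  hausdorff_continuous_at d M S mu.
Proof.
move=> cS usc lsc e e0; apply/near_within_normP.
have e20 : 0 < e / 2 by rewrite divr_gt0.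
have e40 : 0 < e / 2 / 2 by rewrite divr_gt0.
have dball x (r : R) : 0 < r -> nbhs x [set y | d x y < r].
  by move=> r0; apply/(compatible_metric_nbhs hd); exists r.
have up : \forall nu \near within M (nbhs mu),
    (dist_a d (S nu) (S mu) <= (e / 2)%:E)%E.
  have := usc (\bigcup_(x in S mu) ([set y | d x y < e / 2]°)) _ _.
  have H1 : open (\bigcup_(x in S mu) ([set y | d x y < e / 2]°)).
    by apply: bigcup_open => x _; exact: open_interior.
  have H2 : S mu `<=` \bigcup_(x in S mu) ([set y | d x y < e / 2]°).
    by move=> x Sx; exists x => //; exact: dball.
  move=> /(_ H1 H2); apply: filterS => nu SU; apply: dist_a_le => y /SU[x Sx].
  by move=> /interior_subset /= xy; exists x; rewrite // (cmetric_sym hd).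
have low : \forall nu \near within M (nbhs mu),
    (dist_a d (S mu) (S nu) <= (e / 2)%:E)%E.
  have := (compact_near_coveringP (S mu)).1 cS _ (within M (nbhs mu))
    (fun nu x => exists2 y, S nu y & d x y < e / 2) _.
  have H x : S mu x -> \forall x' \near x & nu \near within M (nbhs mu),
      exists2 y, S nu y & d x' y < e / 2.
    move=> Sx; have xb := dball x _ e40.
    exists ([set y | d x y < e / 2 / 2],
            [set nu | S nu `&` [set y | d x y < e / 2 / 2] !=set0]).
      by split; [exact: xb|exact: (lsc _ _ Sx xb)].
    move=> [x' nu] [/= xx' [y [Sy xy]]]; exists y => //.
    (* The radius was halved twice: once for moving from [x] to [x'], and once
       so that the supremum of distances stays strictly below [e]. *)
    rewrite [e / 2]splitr; apply: le_lt_trans (cmetric_triangle hd x' x y) _.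
    by rewrite ltrD// (cmetric_sym hd).
  by move=> /(_ _ H); apply: filterS => nu; exact: dist_a_le.
near=> nu.
have lt2 : ((e / 2)%:E < e%:E)%E.
  by rewrite lte_fin ltr_pdivrMr// ltr_pMr// ltr1n.
rewrite /dist_H gt_max; apply/andP; split.
  by apply: le_lt_trans lt2; near: nu.
by apply: le_lt_trans lt2; near: nu.
Unshelve. all: by end_near. Qed.

(** * The phase space *)

Lemma second_countable_rV (R : realType) (p : nat) :
  @second_countable 'rV[R]_p.
Proof.
pose box (ab : 'rV[rat]_p * 'rV[rat]_p) : set 'rV[R]_p :=
  [set x | forall j, x 0 j \in `]ratr (ab.1 0 j), ratr (ab.2 0 j)[].
have obox ab : open (box ab).
  rewrite openE => x xab.
  exists (fun=> fun j => [set` `]ratr (ab.1 0 j), ratr (ab.2 0 j)[]).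
    move=> i j; rewrite ord1; apply: open_nbhs_nbhs; split; last exact: xab.
    exact: interval_open.
  by move=> y H j; exact: H.
exists (range box).
  by apply: sub_countable (card_image_le _ _) _; exact: countableP.
split=> [_ [ab _ <-]//|x U [P Px PU]].
have /choice[a xa] (j : 'I_p) : exists ab : rat * rat,
    ratr ab.1 < x 0 j < ratr ab.2 /\
    (forall y, ratr ab.1 < y < ratr ab.2 -> P 0 j y).
  have /nbhs_ballP[e /= e0 eP] := Px 0 j.
  have /rat_in_itvoo[a aP] : x 0 j - e < x 0 j by rewrite ltrBlDr ltrDl.
  have /rat_in_itvoo[b bP] : x 0 j < x 0 j + e by rewrite ltrDl.
  exists (a, b); move: aP bP; rewrite !in_itv /= => /andP[ea ax] /andP[xb be].
  split; first by rewrite ax xb.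
  move=> y /andP[ay yb]; apply: eP.
  rewrite /ball /= distrC ltr_distl (lt_trans ea ay) (lt_trans yb be)//.
pose ab := (\row_j (a j).1, \row_j (a j).2).
exists (box ab).
  by split; [exists ab | move=> j; rewrite !mxE in_itv; exact: (xa j).1].
move=> y yab; apply: PU => i j; rewrite ord1.
have := yab j; rewrite !mxE in_itv.
exact: (xa j).2.
Qed.

(** * Continuity of the attractors *)

Theorem theorem5p4 (R : realType) (p q : nat)
    (d : 'rV[R]_p -> 'rV[R]_p -> R) (hd : compatible_metric d)
    (M : set 'rV[R]_q) (hM : compact M)
    (f : 'rV[R]_q -> 'rV[R]_p -> 'rV[R]_p)
    (hf : {within M `*` [set: 'rV[R]_p],
             continuous (fun z : 'rV[R]_q * 'rV[R]_p => f z.1 z.2)})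
    (A : 'rV[R]_q -> set 'rV[R]_p)
    (hA : forall mu, M mu -> is_attractor d (f mu) (A mu))
    (r : 'rV[R]_q -> R)
    (hr0 : forall mu, M mu -> 0 < r mu)
    (hr : forall mu, M mu -> attracts d (f mu) (A mu) (r mu))
    (Omega : set 'rV[R]_p) (hOmega : compact Omega)
    (A1 : forall mu, M mu -> nbhd_ball d (r mu) (A mu) `<=` Omega)
    (N : 'rV[R]_q -> set 'rV[R]_p)
    (hNcompact : forall mu, M mu -> compact (N mu))
    (hNOmega : forall mu, M mu -> N mu `<=` Omega)
    (hNcont : forall mu, M mu -> hausdorff_continuous_at d M N mu)
    (hNinv : forall mu, M mu -> f mu @` N mu `<=` N mu)
    (hAN : forall mu, M mu ->
      A mu = closure (\bigcap_n (iter n (f mu) @` N mu))) :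
  exists S : set 'rV[R]_q,
    residual_in M S /\
    S `<=` [set mu | M mu /\ hausdorff_continuous_at d M A mu].
Proof.
have hq : hausdorff_space 'rV[R]_q by exact: norm_hausdorff.
have hp : hausdorff_space 'rV[R]_p by exact: norm_hausdorff.
have hqp : hausdorff_space ('rV[R]_q * 'rV[R]_p)%type.
  exact: norm_hausdorff.
pose G := [set z : 'rV[R]_q * 'rV[R]_p |
  M z.1 /\ (\bigcap_n (iter n (f z.1) @` N z.1)) z.2].
have cG : compact G.
  apply: compact_graph_bigcap_iter hf _; first exact: hqp.
  apply: (subclosed_compact _ (compact_setX hM hOmega)).
    apply: (hausdorff_continuous_closed_graph hd) => // [|mu Mmu].
      exact: compact_closed.
    exact: compact_closed (hNcompact mu Mmu).
  by move=> z [Mz Nz]; split=> //; exact: hNOmega Nz.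
pose K mu := [set x | G (mu, x)].
(* The closure defining [A mu] adds nothing: fibres of [G] are closed. *)
have AK mu : M mu -> A mu = K mu.
  move=> Mmu; rewrite hAN//.
  have -> : \bigcap_n (iter n (f mu) @` N mu) = K mu.
    by apply/seteqP; split=> [x Nx|x []].
  apply/esym/closure_id.
  have -> : K mu = (fun x => (mu, x)) @^-1` G by [].
  apply: preimage_closed; last exact: compact_closed hqp cG.
  move=> x _; apply: (@cvg_pair _ _ _ (nbhs x) (nbhs mu) (nbhs x)).
    exact: cvg_cst.
  exact: cvg_id.
have hK C : closed C -> closed [set mu | K mu `&` C !=set0].
  exact: closed_hitting_set hq cG.
(* Nowhere density is relative to [M], so the category argument takes place
   in the relative topology of [M]. *)
have hKM C : closed C ->
    closed ([set mu | K mu `&` C !=set0] : set (subspace M)).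
  by move=> cC; apply: closed_subspaceW; exact: hK.
have [F [FK Flsc]] := @lower_semicontinuous_residual (subspace M) 'rV[R]_p K
  (second_countable_rV R p) uniform_regular hKM.
exists (M `\` \bigcup_n F n); split.
  exists F; split=> // n; split; last exact: (FK n).2.
  by move=> mu /(FK n).1[x []].
move=> mu [Mmu Fmu]; split=> //.
apply: (hausdorff_continuous_semicontinuous hd).
- exact: attractor_compact (hA _ Mmu).
- move=> U oU AU; rewrite near_withinE.
  have : nbhs mu (~` [set nu | K nu `&` ~` U !=set0]).
    apply: open_nbhs_nbhs; split; first exact/closed_openC/hK/open_closedC.
    by move=> -[x [Kx Ux]]; apply/Ux/AU; rewrite AK.
  apply: filterS => nu /= hnu Mnu x; rewrite AK// => Kx.
  by apply: contrapT => Ux; apply: hnu; exists x.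
- move=> x U; rewrite AK// => Kx xU.
  have := Flsc mu Fmu x U Kx xU.
  (* Near a point of [M], the relative topology is the filter [within M]. *)
  rewrite {1}/prop_near1 -[nbhs _]/(nbhs_subspace _) -nbhs_subspace_in//.
  rewrite /prop_near1 /within /=; apply: filterS => nu /= H Mnu.
  by rewrite AK//; exact: H.
Qed.
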